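(* Let $\mathcal{A}$ be a finite or countable alphabet, $\mathcal{M}$ a countable set of probability measures on $\mathcal{A}^\infty$, $w:\mathcal{M}\to(0,1]$ a prior with $\sum_{\nu\in\mathcal{M}} w_\nu = 1$, $\xi$ the Bayes mixture, and $\mu\in\mathcal{M}$. For all $\delta\in(0,1)$, with $\mu$-probability at least $1-\delta$, $$D_\infty \le e\cdot \ln\frac{6}{\delta}\cdot\left(\ln\frac{2}{\delta}+\ln\frac{1}{w_\mu}\right).$$
   Context: $\mathcal{A}^\infty$ is the set of infinite sequences over $\mathcal{A}$, equipped with the $\sigma$-algebra generated by the cylinder sets $\Gamma_x=\{x\omega:\omega\in\mathcal{A}^\infty\}$, $x$ a finite string. For a probability measure $\rho$ write $\rho(x):=\rho(\Gamma_x)$ and $\rho(y|x):=\rho(xy)/\rho(x)$. The Bayes mixture is $\xi(A):=\sum_{\nu\in\mathcal{M}} w_\nu\nu(A)$. Logarithms are natural. For a finite string $x$, the KL divergence between predictive distributions is $d_x(\mu,\xi):=\sum_{a\in\mathcal{A}}\mu(a|x)\ln\frac{\mu(a|x)}{\xi(a|x)}$. For $\omega\in\mathcal{A}^\infty$ let $\omega_{<t}=\omega_1\cdots\omega_{t-1}$, $d_t(\omega):=d_{\omega_{<t}}(\mu,\xi)$ and $D_\infty:=\sum_{t=1}^\infty d_t$. *)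

(* Defs.v *)
From HB Require Import structures.
From mathcomp Require Import all_boot all_order all_algebra.
From mathcomp Require Import all_classical all_reals all_analysis.
Unset Printing Implicit Defensive.
Import Order.TTheory GRing.Theory Num.Theory.
Local Open Scope classical_set_scope.
Local Open Scope ring_scope.

(* Infinite sequences over the alphabet A (A countable: a countType, which
   covers finite and countably infinite alphabets; a0 witnesses A <> empty). *)
Definition seqsp (A : countType) (a0 : A) := nat -> A.

HB.instance Definition _ (A : countType) (a0 : A) :=
  gen_eqMixin (seqsp A a0).
HB.instance Definition _ (A : countType) (a0 : A) :=
  gen_choiceMixin (seqsp A a0).
HB.instance Definition _ (A : countType) (a0 : A) :=
  isPointed.Build (seqsp A a0) (fun _ => a0).

(* prefix w k = w_1 ... w_k (0-indexed: w 0, ..., w (k-1)) *)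
Definition prefix (A : countType) (a0 : A) (w : seqsp A a0) (k : nat) : seq A :=
  [seq w i | i <- iota 0 k].

Definition cylinder (A : countType) (a0 : A) (x : seq A) : set (seqsp A a0) :=
  [set w | prefix A a0 w (size x) = x].

Definition cylinders (A : countType) (a0 : A) : set (set (seqsp A a0)) :=
  [set C | exists x : seq A, C = cylinder A a0 x].

Definition Ainf (A : countType) (a0 : A) := g_sigma_algebraType (cylinders A a0).

Section defs.
Variables (A : countType) (a0 : A) (R : realType).
Local Notation T := (Ainf A a0).

Definition cyl (rho : set T -> \bar R) (x : seq A) : R :=
  fine (rho (cylinder A a0 x)).

Definition cond (rho : set T -> \bar R) (y x : seq A) : R :=
  cyl rho (x ++ y) / cyl rho x.

Definition mixture (I : countType) (w : I -> R) (nu : I -> probability T R)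
  (E : set T) : \bar R :=
  (\esum_(i in [set: I]) ((w i)%:E * nu i E))%E.

(* d_x(mu, xi) = sum_a mu(a|x) ln (mu(a|x) / xi(a|x)), the (possibly infinite)
   sum over the countable alphabet taken as (sum of positive parts) minus
   (sum of negative parts) *)
Definition KLpred (mu xi : set T -> \bar R) (x : seq A) : \bar R :=
  let f := fun a : A =>
    (cond mu [:: a] x * ln (cond mu [:: a] x / cond xi [:: a] x))%:E in
  (\esum_(a in [set: A]) maxe (f a) 0 - \esum_(a in [set: A]) maxe (- f a) 0)%E.

Definition Dinf (mu xi : set T -> \bar R) (w : T) : \bar R :=
  (\sum_(0 <= k <oo) KLpred mu xi (prefix A a0 (w : seqsp A a0) k))%E.

End defs.
Arguments cyl {A a0 R}.
Arguments cond {A a0 R}.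
Arguments mixture {A a0 R I}.
Arguments KLpred {A a0 R}.
Arguments Dinf {A a0 R}.

(* Main.v *)
(* For a finite string x let V(x) = ln (xi(x) / (w mu(x))) >= 0, where w is the
   prior weight of mu. Over one symbol V drops in mu-expectation by exactly
   d_x(mu, xi). With L = ln (2/delta) + ln (1/w), lam = 1/(e L) and
   c = 1/((e - 1) L) we have lam (1 + c L) = c, so exp (lam D(x)) (1 + c V(x)),
   where D sums the divergences along x, is a mu-supermartingale as long as
   V <= L. The likelihood ratio xi/mu is a supermartingale too, and V > L means
   xi/mu > 2/delta. Applying the maximal inequality to
     delta/2 * xi/mu + delta/6 * exp (lam D) (1 + c V),
   which starts at most at delta/2 + delta/6 * e/(e - 1) <= delta, bounds by
   delta the probability that V > L or D > e L ln (6/delta) ever happens. *)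
Require Import Defs.
From HB Require Import structures.
From mathcomp Require Import all_boot all_order all_algebra.
From mathcomp Require Import all_classical all_reals all_analysis.
From mathcomp Require Import ring lra.
Set Implicit Arguments.
Unset Strict Implicit.
Unset Printing Implicit Defensive.
Import Order.TTheory GRing.Theory Num.Theory.
Local Open Scope classical_set_scope.
Local Open Scope ring_scope.

(** * Sums and sigma-additivity over countable types *)

Lemma esumZl (R : realType) (T : choiceType) (c : R) (a : T -> \bar R) :
  0 <= c -> (forall i, (0 <= a i)%E) ->
  (\esum_(i in [set: T]) (c%:E * a i) = c%:E * \esum_(i in [set: T]) a i)%E.
Proof.
move=> c0 a0; rewrite /esum -ereal_supZl//; last first.
  apply/set0P; exists (\sum_(i \in set0) a i)%E.
  by exists set0; first exact: fsets_set0.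
congr ereal_sup; apply/seteqP; split => [_ [X XT <-]|_ [_ [X XT <-] <-]].
  by exists (\sum_(i \in X) a i)%E; [exists X|rewrite ge0_mule_fsumr].
by exists X => //; rewrite ge0_mule_fsumr.
Qed.

Lemma exchange_esum (R : realType) (S T : choiceType) (a : S -> T -> \bar R) :
  (forall i j, 0 <= a i j)%E ->
  (\esum_(i in [set: S]) \esum_(j in [set: T]) a i j =
   \esum_(j in [set: T]) \esum_(i in [set: S]) a i j)%E.
Proof.
move=> a0; rewrite !esum_esum//.
rewrite (reindex_esum [set: T * S] _ (fun x => (x.2, x.1))); last first.
  split=> //; first by move=> [x y] [x' y'] _ _ [-> ->].
  by move=> [x y] _; exists (y, x).
by congr esum; apply/seteqP.
Qed.

(** [pickle] carries the family to [nat], with the empty set at codes outside its image. *)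
Lemma measure_countable_bigcup d (R : realType) (T : measurableType d)
    (mu : {measure set T -> \bar R}) (A : countType) (F : A -> set T) :
  (forall a, measurable (F a)) -> trivIset setT F ->
  mu (\bigcup_a F a) = (\esum_(a in [set: A]) mu (F a))%E.
Proof.
move=> mF tF; pose G n := if @pickle_inv A n is Some a then F a else set0.
have -> : \bigcup_a F a = \bigcup_n G n.
  apply/seteqP; split => [x [a _ Fx]|x [n _]].
    by exists (pickle a) => //; rewrite /G pickleK_inv.
  by rewrite /G; case: pickle_inv => // a Fx; exists a.
rewrite measure_semi_bigcup; last 3 first.
- by move=> n; rewrite /G; case: pickle_inv.
- move=> m n _ _ [x []]; rewrite /G.
  have := @pickle_invK A m; have := @pickle_invK A n.
  case: (pickle_inv m) => // a; case: (pickle_inv n) => // b /= <- <- Fa Fb.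
  by congr pickle; apply: tF => //; exists x.
- by apply: bigcup_measurable => n _; rewrite /G; case: pickle_inv.
rewrite nneseries_esumT//.
rewrite [RHS](_ : _ = \esum_(a in [set: A]) mu (G (pickle a)))%E; last first.
  by apply: eq_esum => a _; rewrite /G pickleK_inv.
rewrite -(esum_image [set: A] pickle (fun n => mu (G n))); last first.
  by move=> a b _ _; exact: (pcan_inj pickleK).
rewrite [RHS]esum_mkcond; apply: eq_esum => n _.
case: ifPn => //; rewrite notin_setE => nA; rewrite /G.
have := @pickle_invK A n; case: pickle_inv => [a /= an|].
  by exfalso; apply: nA; exists a.
by rewrite measure0.
Qed.

(* V is meant as the current value of a potential whose value after the symbol
   a is V - ln (p a / q a); the last equation gives its expected next value. *)
Lemma kl_sum_bounds (R : realType) (A : countType) (p q : A -> R) (V : R) :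
  (forall a, 0 <= p a) -> (forall a, 0 <= q a) ->
  (\esum_(a in [set: A]) (p a)%:E = 1)%E ->
  (\esum_(a in [set: A]) (q a)%:E <= 1)%E ->
  0 <= V -> (forall a, p a <= expR V * q a) ->
  let f := fun a => (p a * ln (p a / q a))%:E in
  exists d : R, [/\
   (\esum_(a in [set: A]) maxe (f a) 0 -
    \esum_(a in [set: A]) maxe (- f a) 0 = d%:E)%E, 0 <= d, d <= V &
   (\esum_(a in [set: A]) ((p a * V)%:E - f a) = (V - d)%:E)%E].
Proof.
move=> p0 q0 p1 q1 V0 pq f.
have qp a : 0 < p a -> 0 < q a.
  move=> pa; have := lt_le_trans pa (pq a).
  by rewrite pmulr_rgt0 ?expR_gt0.
have fV a : (f a <= (p a * V)%:E)%E.
  rewrite lee_fin; have := p0 a; rewrite le_eqVlt => /predU1P[<-|pa].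
    by rewrite !mul0r.
  rewrite ler_pM2l// -[leRHS]expRK ler_ln ?posrE ?expR_gt0 ?divr_gt0 ?qp//.
  by rewrite ler_pdivrMr ?qp.
(* This is [ln t <= t - 1] at [t = q a / p a], times [p a]. It bounds the negative part and, summed,
   gives [0 <= d]. *)
have fq a : ((p a)%:E - (q a)%:E <= f a)%E.
  rewrite -EFinB lee_fin; have := p0 a; rewrite le_eqVlt => /predU1P[<-|pa].
    by rewrite mul0r sub0r oppr_le0.
  have qa := qp _ pa.
  have : ln (q a / p a) <= q a / p a - 1.
    have := @le_ln1Dx R (q a / p a - 1); rewrite subrKC; apply.
    by rewrite ltrBrDl subrr divr_gt0.
  rewrite -[p a / q a]invf_div lnV ?posrE ?divr_gt0// => h.
  have := ler_wpM2l (p0 a) h; rewrite mulrBr mulr1 mulrCA divff ?gt_eqF// mulr1.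
  by rewrite mulrN; lra.
have Pf a : (maxe (f a) 0 <= (p a * V)%:E)%E.
  by rewrite ge_max fV lee_fin mulr_ge0.
have Nf a : (maxe (- f a) 0 <= (q a)%:E)%E.
  rewrite ge_max; apply/andP; split; last by rewrite lee_fin.
  have := fq a; have := p0 a; rewrite /f -!EFinN !lee_fin; lra.
have SpV : (\esum_(a in [set: A]) (p a * V)%:E = V%:E)%E.
  under eq_esum do rewrite mulrC EFinM.
  by rewrite esumZl ?p1 ?mule1.
have P0 : (0 <= \esum_(a in [set: A]) maxe (f a) 0)%E.
  by apply: esum_ge0 => a _; rewrite le_max lexx orbT.
have N0 : (0 <= \esum_(a in [set: A]) maxe (- f a) 0)%E.
  by apply: esum_ge0 => a _; rewrite le_max lexx orbT.
have PV : (\esum_(a in [set: A]) maxe (f a) 0 <= V%:E)%E.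
  by rewrite -SpV; apply: le_esum.
have N1 : (\esum_(a in [set: A]) maxe (- f a) 0 <= 1)%E.
  by apply: le_trans q1; apply: le_esum.
have G0 a : (0 <= (p a * V)%:E - f a)%E by rewrite sube_ge0.
have SG0 : (0 <= \esum_(a in [set: A]) ((p a * V)%:E - f a))%E.
  exact: esum_ge0.
(* In [e1] and [e2] negative terms are moved across, so extended sums are only added; finiteness is
   used at the end. *)
have e1 : (\esum_(a in [set: A]) maxe (f a) 0 +
    \esum_(a in [set: A]) ((p a * V)%:E - f a) =
    \esum_(a in [set: A]) maxe (- f a) 0 + V%:E)%E.
  rewrite -SpV -!esumD//;
    try by move=> a _; rewrite ?le_max ?lexx ?orbT ?lee_fin ?mulr_ge0.
  apply: eq_esum => a _; rewrite /f -!EFinN -!EFin_max -!EFinD; congr EFin.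
  by rewrite /Num.max; case: ltP => ?; case: ltP => ?; lra.
have e2 : (\esum_(a in [set: A]) maxe (- f a) 0 + 1 <=
    \esum_(a in [set: A]) maxe (f a) 0 + \esum_(a in [set: A]) (q a)%:E)%E.
  rewrite -p1 -!esumD//;
    try by move=> a _; rewrite ?le_max ?lexx ?orbT ?lee_fin.
  apply: le_esum => a _; have := fq a.
  rewrite /f -!EFinN -!EFin_max -!EFinD !lee_fin.
  by rewrite /Num.max; case: ltP => ?; case: ltP => ?; lra.
have e3 := le_trans e2 (leeD2l _ q1).
move: P0 N0 PV N1 SG0 e1 e3.
case: (\esum_(a in [set: A]) maxe (f a) 0)%E => [x| |]//.
case: (\esum_(a in [set: A]) maxe (- f a) 0)%E => [y| |]//.
case: (\esum_(a in [set: A]) ((p a * V)%:E - f a))%E => [z| |]//.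
rewrite !lee_fin -!EFinD => x0 y0 xV y1 z0 [e1] e3.
by exists (x - y); split; [|lra|lra|congr EFin; lra].
Qed.

(** * Prefixes, cylinders and events decided by finitely many symbols *)

Section cylinders.
Variables (A : countType) (a0 : A).
Local Notation T := (Ainf A a0).
Implicit Types (om : T) (x : seq A).

Lemma size_seqsp_prefix om n : size (Defs.prefix A a0 om n) = n.
Proof. by rewrite size_map size_iota. Qed.

Lemma seqsp_prefixS om n :
  Defs.prefix A a0 om n.+1 = Defs.prefix A a0 om n ++ [:: (om : seqsp A a0) n].
Proof. by rewrite /Defs.prefix -addn1 iotaD map_cat. Qed.

Lemma take_seqsp_prefix om k n : (k <= n)%N ->
  take k (Defs.prefix A a0 om n) = Defs.prefix A a0 om k.
Proof. by move=> kn; rewrite /Defs.prefix -map_take take_iota (minn_idPl kn). Qed.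

Lemma cylinder_nil : cylinder A a0 [::] = setT.
Proof. by apply/seteqP; split. Qed.

Lemma cylinder_cat1 x a om :
  cylinder A a0 (x ++ [:: a]) om <->
  cylinder A a0 x om /\ (om : seqsp A a0) (size x) = a.
Proof.
rewrite /cylinder /= size_cat addn1 seqsp_prefixS; split => [/eqP|[-> ->]//].
by rewrite eqseq_cat ?size_seqsp_prefix// => /andP[/eqP-> /eqP[->]].
Qed.

Lemma cylinder_bigcup x :
  cylinder A a0 x = \bigcup_a cylinder A a0 (x ++ [:: a]).
Proof.
apply/seteqP; split => [om xom|om [a _ /cylinder_cat1[]//]].
by exists (om (size x)) => //; apply/cylinder_cat1.
Qed.

Lemma trivIset_cylinder x :
  trivIset setT (fun a => cylinder A a0 (x ++ [:: a])).
Proof. by move=> a b _ _ [om [/cylinder_cat1[_ <-] /cylinder_cat1[_ <-]]]. Qed.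

Lemma measurable_cylinder x : measurable (cylinder A a0 x : set T).
Proof. by apply: sub_sigma_algebra; exists x. Qed.

(** Strings over [A] are countable in number, so such an event is a countable union of cylinders for
    any [B]. *)
Lemma measurable_prefix n (B : set (seq A)) :
  measurable [set om : T | B (Defs.prefix A a0 om n)].
Proof.
rewrite (_ : [set _ | _] = \bigcup_(x : seq A)
    ([set om : T | B x /\ size x = n] `&` cylinder A a0 x)); last first.
  apply/seteqP; split => [om Bom|om [x _ [[Bx xn] xom]]].
    exists (Defs.prefix A a0 om n) => //; split; first by rewrite /= size_seqsp_prefix.
    by rewrite /cylinder /= size_seqsp_prefix.
  by move: xom; rewrite /cylinder /= xn => ->.
apply: countable_bigcupT_measurable; first exact: countableP.
move=> x; apply: measurableI; last exact: measurable_cylinder.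
have [h|h] := pselect (B x /\ size x = n).
  by rewrite (_ : [set _ | _] = setT)//; apply/seteqP; split.
by rewrite (_ : [set _ | _] = set0)//; apply/seteqP; split.
Qed.

End cylinders.

(** * The Bayes mixture on cylinders *)

Section mixture.
Variables (R : realType) (A : countType) (a0 : A) (I : countType).
Local Notation T := (Ainf A a0).
Variables (nu : I -> probability T R) (w : I -> R).
Hypothesis w_ge0 : forall i, 0 <= w i.

Lemma mixture_ge0 E : (0 <= mixture w nu E)%E.
Proof. by apply: esum_ge0 => i _; rewrite mule_ge0// lee_fin. Qed.

Lemma mixture_ge i E : ((w i)%:E * nu i E <= mixture w nu E)%E.
Proof.
apply: esum_ge; exists [set i]; last by rewrite fsbig_set1.
by split => //; exact: finite_set1.
Qed.

Hypothesis w_sum : (\esum_(i in [set: I]) (w i)%:E = 1)%E.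

Lemma mixture_setT : mixture w nu setT = 1%E.
Proof.
by rewrite /mixture -[RHS]w_sum; apply: eq_esum => i _; rewrite probability_setT mule1.
Qed.

Lemma mixture_le1 E : measurable E -> (mixture w nu E <= 1)%E.
Proof.
move=> mE; rewrite -mixture_setT; apply: le_esum => i _.
by apply: lee_wpmul2l; rewrite ?lee_fin ?probability_setT ?probability_le1.
Qed.

Lemma cyl_probE (P : probability T R) x :
  (cyl P x)%:E = P (cylinder A a0 x).
Proof. by rewrite fineK// fin_num_measure//; exact: measurable_cylinder. Qed.

Lemma cyl_mixtureE x :
  (cyl (mixture w nu) x)%:E = mixture w nu (cylinder A a0 x).
Proof.
rewrite fineK// ge0_fin_numE ?mixture_ge0//.
by apply: (le_lt_trans (mixture_le1 _)); [exact: measurable_cylinder|rewrite ltry].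
Qed.

Lemma cyl_prob_sum (P : probability T R) x :
  (\esum_(a in [set: A]) (cyl P (x ++ [:: a]))%:E = (cyl P x)%:E)%E.
Proof.
rewrite cyl_probE cylinder_bigcup measure_countable_bigcup//.
- by apply: eq_esum => a _; rewrite cyl_probE.
- by move=> a; exact: measurable_cylinder.
- exact: trivIset_cylinder.
Qed.

(** The mixture is not packaged as a measure; additivity comes from each [nu i] by exchanging
    nonnegative sums. *)
Lemma cyl_mixture_sum x :
  (\esum_(a in [set: A]) (cyl (mixture w nu) (x ++ [:: a]))%:E =
   (cyl (mixture w nu) x)%:E)%E.
Proof.
under eq_esum do rewrite cyl_mixtureE.
rewrite exchange_esum; last by move=> a i; rewrite mule_ge0// lee_fin.
rewrite cyl_mixtureE; apply: eq_esum => i _.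
rewrite esumZl// -cyl_probE -cyl_prob_sum.
by under eq_esum do rewrite -cyl_probE.
Qed.

End mixture.

(** * The log-likelihood ratio as a potential *)

Section regret.
Variables (R : realType) (A : countType) (a0 : A).
Local Notation T := (Ainf A a0).
Variables (mu xi : set T -> \bar R) (w : R).
Hypothesis w_gt0 : 0 < w.
Hypothesis mu_ge0 : forall x, 0 <= cyl mu x.
Hypothesis mu_sum : forall x,
  (\esum_(a in [set: A]) (cyl mu (x ++ [:: a]))%:E = (cyl mu x)%:E)%E.
Hypothesis xi_sum : forall x,
  (\esum_(a in [set: A]) (cyl xi (x ++ [:: a]))%:E = (cyl xi x)%:E)%E.
Hypothesis mu_xi : forall x, w * cyl mu x <= cyl xi x.

(** The [V] of the overview. Where [cyl mu x = 0], the conventions [y / 0 = 0] and [ln 0 = 0] make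
    it 0. *)
Definition regret (x : seq A) : R := ln (cyl xi x / (w * cyl mu x)).

Lemma xi_ge0 x : 0 <= cyl xi x.
Proof. by apply: le_trans (mu_xi x); rewrite mulr_ge0// ltW. Qed.

Lemma xi_gt0 x : 0 < cyl mu x -> 0 < cyl xi x.
Proof. by move=> h; apply: lt_le_trans (mu_xi x); rewrite mulr_gt0. Qed.

Lemma regret_ge0 x : 0 <= regret x.
Proof.
have := mu_ge0 x; rewrite le_eqVlt => /predU1P[h|h].
  by rewrite /regret -h mulr0 invr0 mulr0 ln0.
by apply: ln_ge0; rewrite ler_pdivlMr ?mul1r// mulr_gt0.
Qed.

Lemma cyl_cat1_eq0 x a : cyl mu x = 0 -> cyl mu (x ++ [:: a]) = 0.
Proof.
move=> h; apply/eqP; rewrite eq_le mu_ge0 andbT -[leRHS]h -lee_fin -(mu_sum x).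
apply: esum_ge; exists [set a]; last by rewrite fsbig_set1.
by split => //; exact: finite_set1.
Qed.

(* The regret is a potential for KLpred: its expected drop over one symbol is
   exactly the divergence between the predictive distributions. *)
Lemma KLpred_regret x : exists d : R, [/\ KLpred mu xi x = d%:E,
   0 <= d, d <= regret x &
   (\esum_(a in [set: A]) (cyl mu (x ++ [:: a]) * regret (x ++ [:: a]))%:E =
    (cyl mu x * (regret x - d))%:E)%E].
Proof.
have := mu_ge0 x; rewrite le_eqVlt => /predU1P[/esym h|h].
  exists 0; split => //; last 2 first.
  - exact: regret_ge0.
  - by rewrite h mul0r; apply: esum1 => a _; rewrite cyl_cat1_eq0// mul0r.
  rewrite /KLpred !esum1 ?sube0// => a _;
    by rewrite /cond cyl_cat1_eq0// !mul0r ?oppe0 maxxx.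
have hx := xi_gt0 h.
have [||||||d [dE d0 dV ds]] := @kl_sum_bounds R A (fun a => cond mu [:: a] x)
  (fun a => cond xi [:: a] x) (regret x).
- by move=> a; rewrite divr_ge0.
- by move=> a; rewrite divr_ge0// xi_ge0.
- rewrite /cond; under eq_esum do rewrite mulrC EFinM.
  rewrite esumZl ?mu_sum; first by rewrite -EFinM mulVf ?gt_eqF.
  + by rewrite invr_ge0.
  + by move=> a; rewrite lee_fin.
- rewrite /cond; under eq_esum do rewrite mulrC EFinM.
  rewrite esumZl ?xi_sum; first by rewrite -EFinM mulVf ?gt_eqF.
  + by rewrite invr_ge0 xi_ge0.
  + by move=> a; rewrite lee_fin xi_ge0.
- exact: regret_ge0.
(* As [expR (regret x) * cond xi [:: a] x] is [cyl xi (x ++ [:: a]) / (w * cyl mu x)], this is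
   [mu_xi] at the extended string. *)
- move=> a; rewrite /regret lnK ?posrE ?divr_gt0 ?mulr_gt0//.
  rewrite /cond ler_pdivrMr//.
  rewrite [leRHS](_ : _ = cyl xi (x ++ [:: a]) / w); last first.
    by field; rewrite !gt_eqF.
  by rewrite ler_pdivlMr// mulrC.
exists d; split => //.
(* Reading [a] changes the regret by minus the log ratio of the predictive probabilities. *)
have key a : cyl mu (x ++ [:: a]) * regret (x ++ [:: a]) =
    cyl mu x * (cond mu [:: a] x * regret x -
      cond mu [:: a] x * ln (cond mu [:: a] x / cond xi [:: a] x)).
  have := mu_ge0 (x ++ [:: a]); rewrite le_eqVlt => /predU1P[/esym ha|ha].
    by rewrite /cond ha !mul0r subr0 mulr0.
  have hxa := xi_gt0 ha.
  rewrite -mulrBr /cond mulrA [cyl mu x * _]mulrC divfK ?gt_eqF//; congr (_ * _).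
  rewrite /regret -ln_div ?posrE ?divr_gt0 ?mulr_gt0//; congr ln.
  by field; rewrite !gt_eqF.
rewrite EFinM -ds -esumZl; last 2 first.
- exact: mu_ge0.
- by move=> a; rewrite -EFinB lee_fin -(pmulr_rge0 _ h) -key mulr_ge0// regret_ge0.
by apply: eq_esum => a _; rewrite -EFinB -EFinM key.
Qed.

End regret.

(* A Ville-type inequality: P is a supermartingale, relative to mu and scaled by
   it, until the path enters B, where it dominates mu. *)
Section maximal_inequality.
Variables (R : realType) (A : countType) (a0 : A).
Local Notation T := (Ainf A a0).
Variables (mu : probability T R) (B : set (seq A)) (P : seq A -> R).
Hypothesis P_ge0 : forall x, 0 <= P x.
Hypothesis mu_le : forall x, B x -> cyl mu x <= P x.
Hypothesis P_sum : forall x, ~ B x ->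
  (\esum_(a in [set: A]) (P (x ++ [:: a]))%:E <= (P x)%:E)%E.

(** A finite horizon [n] beyond [x] allows induction on [n] for all [x] at once; [k = size x]
    counts, as [x] itself may lie in [B]. *)
Let hit n x : set T := cylinder A a0 x `&`
  \bigcup_(k in [set k | size x <= k <= size x + n]%N)
    [set om | B (Defs.prefix A a0 om k)].

Let measurable_hit n x : measurable (hit n x).
Proof.
apply: measurableI; first exact: measurable_cylinder.
by apply: bigcup_measurable => k _; exact: measurable_prefix.
Qed.

Let hitS n x : ~ B x -> hit n.+1 x = \bigcup_a hit n (x ++ [:: a]).
Proof.
move=> Bx; apply/seteqP; split => [om [xom [k /= /andP[]]]|om [a _]].
  rewrite leq_eqVlt => /predU1P[<- _|xk kn].
    by rewrite /= (xom : Defs.prefix _ _ _ _ = _).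
  move=> Bk; exists ((om : seqsp A a0) (size x)) => //.
  split; first exact/cylinder_cat1.
  by exists k => //=; rewrite size_cat addn1 xk addSnnS.
move=> [/cylinder_cat1[xom _]] [k /=]; rewrite size_cat addn1 addSnnS.
by move=> /andP[xk kn] Bk; split => //; exists k => //=; rewrite (ltnW xk).
Qed.

(** First-step analysis: inside [B] the cylinder mass is at most [P x]; outside, [hitS] splits by
    the next symbol and [P_sum] collects the bounds. *)
Let hit_le n x : (mu (hit n x) <= (P x)%:E)%E.
Proof.
elim: n x => [|n IH] x; have [Bx|Bx] := pselect (B x).
1,3: apply: (@le_trans _ _ (cyl mu x)%:E); last by rewrite lee_fin mu_le.
1,2: by rewrite cyl_probE le_measure ?inE//;
  [exact: measurable_cylinder|exact: subIsetl].
- rewrite (_ : hit 0 x = set0) ?measure0 ?lee_fin//.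
  apply/seteqP; split => // om [xom [k /=]]; rewrite addn0 -eqn_leq => /eqP <-.
  by rewrite (xom : Defs.prefix _ _ _ _ = _).
- rewrite hitS// measure_countable_bigcup//; last first.
    move=> a b _ _ [om [[xa _] [xb _]]].
    by apply: (@trivIset_cylinder A a0 x) => //; exists om.
  by apply: le_trans (P_sum Bx); apply: le_esum => a _; exact: IH.
Qed.

Lemma maximal_inequality :
  (mu [set om : T | exists k, B (Defs.prefix A a0 om k)] <= (P [::])%:E)%E.
Proof.
have -> : [set om : T | exists k, B (Defs.prefix A a0 om k)] =
    \bigcup_n hit n [::].
  apply/seteqP; split => [om [k Bk]|om [n _ [_ [k _ Bk]]]]; last by exists k.
  by exists k => //; split; [rewrite cylinder_nil|exists k => //=; rewrite leqnn].
(* Continuity from below lets the horizon grow to infinity. *)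
have h : mu (hit n [::]) @[n --> \oo] --> mu (\bigcup_n hit n [::]).
  apply: nondecreasing_cvg_mu => [n| |m n mn].
  - exact: measurable_hit.
  - by apply: bigcup_measurable => n _; exact: measurable_hit.
  - apply/subsetPset => om [nom [k /= km Bk]]; split => //.
    by exists k => //=; exact: leq_trans mn.
rewrite -(cvg_lim _ h)//; apply: lime_le; first by apply/cvg_ex; eexists; exact: h.
by apply: nearW => n; exact: hit_le.
Qed.

End maximal_inequality.

(** * The exponential supermartingale *)

Section exponential_supermartingale.
Variables (R : realType) (A : countType) (a0 : A).
Local Notation T := (Ainf A a0).
Variables (mu xi : set T -> \bar R) (w : R).
Hypothesis w_gt0 : 0 < w.
Hypothesis mu_ge0 : forall x, 0 <= cyl mu x.
Hypothesis mu_sum : forall x,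
  (\esum_(a in [set: A]) (cyl mu (x ++ [:: a]))%:E = (cyl mu x)%:E)%E.
Hypothesis xi_sum : forall x,
  (\esum_(a in [set: A]) (cyl xi (x ++ [:: a]))%:E = (cyl xi x)%:E)%E.
Hypothesis mu_xi : forall x, w * cyl mu x <= cyl xi x.

(** Only proper prefixes count: the divergence at [x] enters when the next symbol is read. By
    [KLpred_fin_num], [fine] loses nothing. *)
Definition KLsum (x : seq A) : R :=
  \sum_(0 <= k < size x) fine (KLpred mu xi (take k x)).

Lemma KLsum_nil : KLsum [::] = 0.
Proof. by rewrite /KLsum big_geq. Qed.

Lemma KLsum_cat1 x a : KLsum (x ++ [:: a]) = KLsum x + fine (KLpred mu xi x).
Proof.
rewrite /KLsum size_cat addn1 big_nat_recr//= take_size_cat//; congr (_ + _).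
by apply: eq_big_nat => k /andP[_ /ltnW kx]; rewrite takel_cat.
Qed.

Lemma KLpred_fin_num x : KLpred mu xi x \is a fin_num.
Proof. by have [d [->]] := KLpred_regret w_gt0 mu_ge0 mu_sum xi_sum mu_xi x. Qed.

Lemma KLpred_ge0 x : (0 <= KLpred mu xi x)%E.
Proof. by have [d [-> ? _ _]] := KLpred_regret w_gt0 mu_ge0 mu_sum xi_sum mu_xi x. Qed.

(** Nonnegative terms make the series the supremum of its partial sums, each a function of a prefix;
    this serves measurability and the maximal inequality. *)
Lemma Dinf_leP (om : T) (K : R) : (Dinf mu xi om <= K%:E)%E <->
  forall n, KLsum (Defs.prefix A a0 om n) <= K.
Proof.
have sumE n : (\sum_(0 <= k < n) KLpred mu xi (Defs.prefix A a0 om k) =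
    (KLsum (Defs.prefix A a0 om n))%:E)%E.
  rewrite /KLsum size_seqsp_prefix -sumEFin; apply: eq_big_nat => k /andP[_ kn].
  by rewrite take_seqsp_prefix 1?ltnW// fineK// KLpred_fin_num.
split => [h n|h].
  rewrite -lee_fin -sumE; apply: le_trans h; apply: nneseries_lim_ge => k _ _.
  exact: KLpred_ge0.
apply: lime_le; first by apply: is_cvg_nneseries => k _ _; exact: KLpred_ge0.
by apply: nearW => n; rewrite sumE lee_fin.
Qed.

Lemma measurable_Dinf_le (K : R) :
  measurable [set om : T | (Dinf mu xi om <= K%:E)%E].
Proof.
rewrite (_ : [set _ | _] =
    \bigcap_n [set om : T | KLsum (Defs.prefix A a0 om n) <= K]).
  apply: bigcap_measurableType => n _.
  exact: (@measurable_prefix A a0 n [set x | KLsum x <= K]).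
apply/seteqP; split => [om /Dinf_leP h n _|om h]; first exact: h.
by apply/Dinf_leP => n; exact: h.
Qed.

Variables (lam c L : R).
Hypotheses (lam_ge0 : 0 <= lam) (c_ge0 : 0 <= c).
Hypothesis lam_c : lam * (1 + c * L) <= c.

(** The factor [cyl mu x] turns conditional expectation into a plain sum over the next symbol, and
    [mu]-null strings get the value 0. *)
Definition exp_potential (x : seq A) : R :=
  expR (lam * KLsum x) * (cyl mu x * (1 + c * regret mu xi w x)).

Lemma exp_potential_ge0 x : 0 <= exp_potential x.
Proof.
rewrite mulr_ge0 ?expR_ge0// mulr_ge0// addr_ge0// mulr_ge0//.
exact: regret_ge0.
Qed.

(** The divergence [d] at [x] is the same for each next symbol, so [expR (lam * d)] factors out; the
    expected drop [d] of the regret pays for it. *)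
Lemma exp_potential_sum x : regret mu xi w x <= L ->
  (\esum_(a in [set: A]) (exp_potential (x ++ [:: a]))%:E <=
   (exp_potential x)%:E)%E.
Proof.
move=> VL.
have [d [dE d0 dV ds]] := KLpred_regret w_gt0 mu_ge0 mu_sum xi_sum mu_xi x => //.
set V := regret _ _ _ _ in VL dV ds *.
rewrite [leLHS](_ : _ = (expR (lam * (KLsum x + d)) *
    (cyl mu x + c * (cyl mu x * (V - d))))%:E).
  rewrite lee_fin /exp_potential -/V [lam * (_ + _)]mulrDr expRD -mulrA.
  rewrite ler_wpM2l ?expR_ge0//.
  rewrite [leLHS](_ : _ = cyl mu x * (expR (lam * d) * (1 + c * (V - d))));
    last by ring.
  rewrite ler_wpM2l//.
  (* exp (- lam d) >= 1 - lam d reduces the claim to lam (1 + c V) <= c. *)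
  rewrite -ler_pdivlMl ?expR_gt0// -expRN.
  have := @expR_ge1Dx _ (- (lam * d)); have : lam * (1 + c * V) <= c.
    by apply: le_trans lam_c; rewrite ler_wpM2l// lerD2l ler_wpM2l.
  move=> h1 h2; have V0 : 0 <= 1 + c * V.
    by rewrite addr_ge0// mulr_ge0// (le_trans d0).
  apply: le_trans (ler_wpM2r V0 h2).
  by have := ler_wpM2r d0 h1; lra.
rewrite EFinM EFinD EFinM -ds -mu_sum -esumZl//; last first.
  by move=> a; rewrite lee_fin mulr_ge0//; exact: regret_ge0.
rewrite -esumD; last 2 first.
- by move=> a _; rewrite lee_fin.
- by move=> a _; rewrite -EFinM lee_fin !mulr_ge0//; exact: regret_ge0.
rewrite -esumZl ?expR_ge0//; last first.
  move=> a; rewrite -EFinM -EFinD lee_fin addr_ge0// !mulr_ge0//.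
  exact: regret_ge0.
apply: eq_esum => a _; rewrite -EFinM; congr EFin.
by rewrite /exp_potential KLsum_cat1 dE /=; ring.
Qed.

End exponential_supermartingale.

(** * Constants, bad strings and the probability bound *)

Unset Implicit Arguments.

Theorem theorem3 (R : realType) (A : countType) (a0 : A) (I : countType)
  (nu : I -> probability (Ainf A a0) R) (w : I -> R)
  (w_pos : forall i, 0 < w i) (w_le1 : forall i, w i <= 1)
  (w_sum : (\esum_(i in [set: I]) (w i)%:E)%E = 1%E)
  (i0 : I) (delta : R) (delta_pos : 0 < delta) (delta_lt1 : delta < 1) :
  let mu := nu i0 in
  let xi := mixture w nu in
  let E := [set om : Ainf A a0 | (Dinf mu xi om <=
     (expR 1 * ln (6 / delta) * (ln (2 / delta) + ln (1 / w i0)))%:E)%E] in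
  measurable E /\ (mu E >= (1 - delta)%:E)%E.
Proof.
move=> mu xi E.
have w_ge0 i : 0 <= w i by exact: ltW.
have mu_ge0 x : 0 <= cyl mu x by exact: fine_ge0.
have mu_sum := cyl_prob_sum mu.
have xi_sum := cyl_mixture_sum nu w_ge0 w_sum.
have mu_xi x : w i0 * cyl mu x <= cyl xi x.
  by rewrite -lee_fin EFinM cyl_probE cyl_mixtureE//; exact: mixture_ge.
have xi0 x : 0 <= cyl xi x by apply: le_trans (mu_xi x); rewrite mulr_ge0.
pose L := ln (2 / delta) + ln (1 / w i0).
pose K := expR 1 * ln (6 / delta) * L.
have e2 : 2 <= expR 1 :> R by have := @expR_ge1Dx R 1; lra.
have L_gt0 : 0 < L.
  rewrite ltr_pwDl// ?ln_gt0 ?ln_ge0//; first by rewrite ltr_pdivlMr//; lra.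
  by rewrite ler_pdivlMr// mul1r.
have mE : measurable E by exact: (measurable_Dinf_le (w_pos i0)).
split => //.
pose lam := (expR 1 * L)^-1; pose c := ((expR 1 - 1) * L)^-1.
have eL0 : 0 < expR 1 * L by rewrite mulr_gt0//; lra.
have e1L0 : 0 < (expR 1 - 1) * L by rewrite mulr_gt0//; lra.
have lam_ge0 : 0 <= lam by rewrite invr_ge0 ltW.
have c_ge0 : 0 <= c by rewrite invr_ge0 ltW.
have cL : 1 + c * L = expR 1 / (expR 1 - 1).
  by rewrite /c; field; rewrite !gt_eqF//; lra.
have lam_c : lam * (1 + c * L) <= c.
  rewrite cL le_eqVlt; apply/orP; left; apply/eqP; rewrite /lam /c.
  by field; rewrite !gt_eqF//; lra.
pose V := regret mu xi (w i0).
pose Z := exp_potential mu xi (w i0) lam c.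
pose D := KLsum mu xi.
have V0 x : 0 <= V x by exact: regret_ge0.
have Z0 x : 0 <= Z x by exact: exp_potential_ge0.
have d2 : 0 <= delta / 2 by lra.
have d6 : 0 <= delta / 6 by lra.
(* Counting [L < V x] as bad keeps the regret at most [L] before entry, as [exp_potential_sum]
   requires. *)
pose B := [set x : seq A | K < D x \/ L < V x].
pose P x := delta / 2 * cyl xi x + delta / 6 * Z x.
have P0 : P [::] <= delta.
  rewrite /P /Z /exp_potential KLsum_nil mulr0 expR0 mul1r.
  have xi1 : cyl xi [::] = 1 by rewrite /cyl cylinder_nil /xi mixture_setT.
  have mu1 : cyl mu [::] = 1 by rewrite /cyl cylinder_nil probability_setT.
  rewrite xi1 mu1 mul1r mulr1.
  have VL : V [::] <= L.
    rewrite /V /regret mu1 xi1 mulr1 /L.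
    by rewrite lerDr ln_ge0// ler_pdivlMr//; lra.
  (* The constant 6 of the bound leaves room for 3: [delta / 2 + 3 * (delta / 6) = delta]. The
     estimate holds because [e >= 2] gives [e / (e - 1) <= 2]. *)
  have : 1 + c * V [::] <= 3.
    apply: (@le_trans _ _ (1 + c * L)); first by rewrite lerD2l ler_wpM2l.
    by rewrite cL ler_pdivrMr; lra.
  by rewrite -/V => h; have := ler_wpM2l (ltW delta_pos) h; lra.
have hit : (mu [set om | exists k, B (Defs.prefix A a0 om k)] <= (P [::])%:E)%E.
  apply: maximal_inequality.
  - by move=> x; rewrite addr_ge0// mulr_ge0.
  - move=> x Bx; have := mu_ge0 x; rewrite le_eqVlt => /predU1P[<-|m0].
      by rewrite addr_ge0// mulr_ge0.
    case: Bx => [KD|LV].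
      (* Since [lam * K = ln (6 / delta)], the exponential term alone dominates [cyl mu x]. *)
      apply: ler_wpDl; first by rewrite mulr_ge0.
      have e6 : 6 / delta <= expR (lam * D x).
        rewrite -[leLHS]lnK ?posrE ?divr_gt0// ler_expR.
        rewrite -(ler_pM2l eL0) /lam mulrA divff ?gt_eqF// mul1r.
        by rewrite mulrAC; exact: ltW.
      have h : cyl mu x <= cyl mu x * (1 + c * V x).
        by rewrite ler_peMr// lerDl mulr_ge0.
      have mZ : 6 / delta * cyl mu x <= Z x by rewrite ler_pM// divr_ge0// ltW.
      rewrite [leLHS](_ : _ = delta / 6 * (6 / delta * cyl mu x)); last first.
        by field; rewrite gt_eqF.
      by rewrite ler_wpM2l.
    (* The prior weight in [L] cancels that in [V x]: [L < V x] says that [cyl xi x] exceeds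
       [2 / delta * cyl mu x]. *)
    apply: ler_wpDr; first by rewrite mulr_ge0.
    move: LV; rewrite /L /V /regret -lnM ?posrE ?divr_gt0//.
    have q0 : 0 < cyl xi x by exact: (xi_gt0 (w_pos i0)).
    have l0 : 0 < 2 / delta * (1 / w i0) by rewrite mulr_gt0// divr_gt0.
    rewrite ltr_ln ?posrE//; last by rewrite divr_gt0 ?mulr_gt0.
    rewrite ltr_pdivlMr ?mulr_gt0// => /ltW LV.
    rewrite [leLHS](_ : _ =
        delta / 2 * (2 / delta * (1 / w i0) * (w i0 * cyl mu x))); last first.
      by field; rewrite !gt_eqF.
    by rewrite ler_wpM2l.
  (* The [xi] term is preserved exactly by [xi_sum]; only the exponential term uses [V x <= L]. *)
  - move=> x /not_orP[/negP + /negP]; rewrite -!leNgt => DK VL.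
    rewrite /P; under eq_esum do rewrite EFinD (EFinM (delta / 2)) (EFinM (delta / 6)).
    rewrite esumD; last 2 first.
    + by move=> a _; rewrite mule_ge0// lee_fin.
    + by move=> a _; rewrite mule_ge0// lee_fin.
    rewrite esumZl//; last by move=> a; rewrite lee_fin.
    rewrite esumZl//; last by move=> a; rewrite lee_fin.
    rewrite xi_sum EFinD (EFinM (delta / 2)) (EFinM (delta / 6)) leeD2l//.
    rewrite lee_wpmul2l ?lee_fin//.
    exact: (exp_potential_sum (w_pos i0) mu_ge0 mu_sum xi_sum mu_xi
              lam_ge0 c_ge0 lam_c VL).
rewrite -[E]setCK probability_setC; last exact: measurableC.
rewrite EFinB leeB//.
apply: (@le_trans _ _ (P [::])%:E); last by rewrite lee_fin.
apply: le_trans hit; apply: le_measure; rewrite ?inE.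
- exact: measurableC.
- rewrite (_ : [set _ | _] = \bigcup_k [set om | B (Defs.prefix A a0 om k)]).
    by apply: bigcup_measurable => k _; exact: measurable_prefix.
  by apply/seteqP; split => om [k]; exists k.
(* A value of [Dinf] above [K] shows in some partial sum, hence in an entry into [B]. *)
- move=> om; apply: contra_notP => /forallNP h; apply/Dinf_leP => // n.
  by rewrite leNgt; apply/negP => KD; apply: (h n); left.
Qed.
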